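(* Let $s\ge 1$ be a real number and $k\in\{2,3,4\}$, and set $\tau_2=0$, $\tau_3=0.094$, $\tau_4=0.275$. Then there exist a symmetric positive definite matrix $H_k=(h^k_{i,j})\in\mathbb{R}^{k\times k}$ and real numbers $\theta_0,\dots,\theta_k$ such that for all $\phi^{n-k+1},\phi^{n-k+2},\dots,\phi^{n+1}$ in $L^2(\Omega)$, $$\Big(A^s_k(\phi^{n+1}),\,B^s_k(\phi^{n+1})+\tau_k C^s_k(\phi^{n+1})\Big)=\sum_{i,j=1}^k h^k_{i,j}\,(\phi^{n-k+1+i},\phi^{n-k+1+j})-\sum_{i,j=1}^k h^k_{i,j}\,(\phi^{n-k+i},\phi^{n-k+j})+\Big\|\sum_{i=0}^k\theta_i\,\phi^{n-k+1+i}\Big\|^2 .$$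
   Context: $(\cdot,\cdot)$ and $\|\cdot\|$ are the inner product and norm of $L^2(\Omega)$, where $\Omega\subset\mathbb{R}^d$ ($d\in\{1,2,3\}$) is open and bounded. For a sequence $(\phi^j)$ and $s\in\mathbb{R}$ define $$A^s_k(\phi^n)=\sum_{q=0}^k a_{k,q}\phi^{n-k+q},\quad B^s_k(\phi^n)=\sum_{q=0}^{k-1}b_{k,q}\phi^{n-k+1+q},\quad C^s_k(\phi^n)=\sum_{q=0}^{k-1}c_{k,q}\phi^{n-k+1+q},$$ with the following coefficients (functions of $s$). $k=2$: $a_{2,2}=\frac{2s+1}{2}$, $a_{2,1}=-2s$, $a_{2,0}=\frac{2s-1}{2}$; $b_{2,1}=s$, $b_{2,0}=-(s-1)$; $c_{2,1}=s+1$, $c_{2,0}=-s$. $k=3$: $a_{3,3}=\frac{3s^2+6s+2}{6}$, $a_{3,2}=-\frac{9s^2+12s-3}{6}$, $a_{3,1}=\frac{9s^2+6s-6}{6}$, $a_{3,0}=-\frac{3s^2-1}{6}$; $b_{3,2}=\frac{s^2+s}{2}$, $b_{3,1}=-(s^2-1)$, $b_{3,0}=\frac{s^2-s}{2}$; $c_{3,2}=\frac{s^2+3s+2}{2}$, $c_{3,1}=-(s^2+2s)$, $c_{3,0}=\frac{s^2+s}{2}$. $k=4$: $a_{4,4}=\frac{2s^3+9s^2+11s+3}{12}$, $a_{4,3}=\frac{-8s^3-30s^2-20s+10}{12}$, $a_{4,2}=\frac{12s^3+36s^2+6s-18}{12}$, $a_{4,1}=\frac{-8s^3-18s^2+4s+6}{12}$,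 $a_{4,0}=\frac{2s^3+3s^2-s-1}{12}$; $b_{4,3}=\frac{s^3+3s^2+2s}{6}$, $b_{4,2}=\frac{-s^3-2s^2+s+2}{2}$, $b_{4,1}=\frac{s^3+s^2-2s}{2}$, $b_{4,0}=\frac{-s^3+s}{6}$; $c_{4,3}=\frac{s^3+6s^2+11s+6}{6}$, $c_{4,2}=\frac{-s^3-5s^2-6s}{2}$, $c_{4,1}=\frac{s^3+4s^2+3s}{2}$, $c_{4,0}=\frac{-s^3-3s^2-2s}{6}$. *)

(* Defs.v *)
From HB Require Import structures.
From mathcomp Require Import all_boot all_order all_algebra.
From mathcomp Require Import all_classical all_reals all_analysis.

Set Implicit Arguments.
Unset Strict Implicit.
Unset Printing Implicit Defensive.

Import Order.TTheory GRing.Theory Num.Theory.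
Import numFieldNormedType.Exports.

Local Open Scope classical_set_scope.
Local Open Scope ring_scope.

Notation borel_rV R d := (g_sigma_algebraType (@open 'rV[R]_d)).

Section lebesgue_measure_rV.
Variable R : realType.

Lemma open_measurable_rV (d : nat) (O : set 'rV[R]_d) :
  open O -> measurable (O : set (borel_rV R d)).
Proof. exact: sub_sigma_algebra. Qed.

Definition ratball (d : nat) (q : 'rV[rat]_d * nat) : set 'rV[R]_d :=
  ball (map_mx ratr q.1 : 'rV[R]_d) (q.2.+1%:R^-1 : R).

Lemma open_bigcup_ratball (d : nat) (O : set 'rV[R]_d) : open O ->
  O = \bigcup_(q in [set q | ratball q `<=` O]) ratball q.
Proof.
move=> oO; apply/seteqP; split => [x Ox|x [q /= qO]]; last exact: qO.
have /nbhs_ballP[e /= e0 xeO] : nbhs x O by exact: open_nbhs_nbhs.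
have e20 : 0 < e / 2 by rewrite divr_gt0.
have [k ke] : exists k : nat, k.+1%:R^-1 < e / 2.
  have [k] := ltr_add_invr (e20 : 0 < e / 2).
  by rewrite add0r => ke; exists k.
have k0 : 0 < k.+1%:R^-1 :> R by rewrite invr_gt0.
have H i : {q : rat | ratr q \in `]x 0 i - k.+1%:R^-1, x 0 i + k.+1%:R^-1[%R}.
  by apply/cid/rat_in_itvoo; rewrite ltrD2l gtrN.
exists (\row_i projT1 (H i), k) => /=; last first.
  split=> // i j; rewrite !mxE ord1 /ball /= ltr_distl.
  by have := projT2 (H j); rewrite in_itv.
move=> v [_ vq]; apply: xeO; split=> // i j; rewrite ord1.
have := vq 0 j; rewrite !mxE /ball /= => h2.
have h1 : `|x 0 j - ratr (projT1 (H j))| < k.+1%:R^-1.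
  by rewrite distrC ltr_distl; have := projT2 (H j); rewrite in_itv.
rewrite (le_lt_trans (ler_distD (ratr (projT1 (H j))) _ _))//.
by rewrite [ltRHS](splitr e) ltrD// (lt_trans _ ke).
Qed.

Definition cons_rV (d : nat) (x : measurableTypeR R * borel_rV R d) :
    borel_rV R d.+1 :=
  \row_(i < d.+1) oapp ((x.2 : 'rV[R]_d) 0) x.1 (unlift ord0 i).

Definition behead_rV (d : nat) (v : borel_rV R d.+1) :
    measurableTypeR R * borel_rV R d :=
  ((v : 'rV[R]_d.+1) 0 ord0, \row_(i < d) (v : 'rV[R]_d.+1) 0 (lift ord0 i)).

Lemma cons_rVK (d : nat) : cancel (@cons_rV d) (@behead_rV d).
Proof.
move=> [x v]; rewrite /behead_rV /cons_rV mxE unlift_none /=; congr pair.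
by apply/rowP => i; rewrite !mxE liftK.
Qed.

Lemma continuous_measurable_rV (d d' : nat) (f : 'rV[R]_d -> 'rV[R]_d') :
  continuous f ->
  measurable_fun setT (f : borel_rV R d -> borel_rV R d').
Proof.
move=> cf.
apply: (@measurability _ _ _ (borel_rV R d') _ _ (@open 'rV[R]_d')) => //.
move=> _ [U oU <-]; rewrite setTI.
apply: open_measurable_rV.
by move: cf => /continuousP; apply.
Qed.

Lemma measurable_cons_rV (d : nat) : measurable_fun setT (@cons_rV d).
Proof.
apply: (@measurability _ _ _ (borel_rV R d.+1) _ _ (@open 'rV[R]_d.+1)) => //.
move=> _ [U oU <-]; rewrite setTI (open_bigcup_ratball oU) preimage_bigcup.
rewrite bigcup_mkcond; apply: countable_bigcupT_measurable => [|q].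
  exact: countableP.
case: ifPn => // _.
have -> : cons_rV (d:=d) @^-1` ratball q =
    (ball (ratr (q.1 0 ord0) : R) (q.2.+1%:R^-1) : set R) `*`
    (ball (\row_(i < d) ratr (q.1 0 (lift ord0 i)) : 'rV[R]_d)
      (q.2.+1%:R^-1) : set 'rV[R]_d).
  apply/seteqP; split => [[x v] [r0 xv]|[x v] [/= xq [r0 vq]]].
    split; first by have := xv 0 ord0; rewrite !mxE unlift_none.
    split=> // i j; rewrite ord1.
    by have := xv 0 (lift ord0 j); rewrite !mxE liftK.
  split=> // i j; rewrite ord1 !mxE; case: unliftP => [k ->|->] //=.
  by have := vq 0 k; rewrite !mxE.
apply: measurableX; first exact: measurable_realfun.measurable_ball.
by apply: open_measurable_rV; exact: ball_open.
Qed.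

Lemma measurable_coord_rV (d : nat) (i : 'I_d) :
  measurable_fun setT
    (fun v : borel_rV R d => (v : 'rV[R]_d) 0 i : measurableTypeR R).
Proof.
apply: (measurability _ (measurable_realfun.RGenOpens.measurableE R)).
move=> _ [_ [a [b ->] <-]]; rewrite setTI; apply: open_measurable_rV.
have /continuousP := @coord_continuous R 1 d 0 i; apply.
exact: interval_open.
Qed.

Lemma measurable_behead_rV (d : nat) : measurable_fun setT (@behead_rV d).
Proof.
apply: measurable_fun_pair; first exact: measurable_coord_rV.
apply: (@continuous_measurable_rV d.+1 d
  (fun v => \row_(i < d) v 0 (lift ord0 i))).
move=> v A /nbhs_ballP[e /= e0 eA]; apply/nbhs_ballP; exists e => //.
by move=> w [_ vw]; apply: eA; split=> // i j; rewrite !mxE; exact: vw.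
Qed.

Section lebesgue_rV_succ.
Variables (d : nat) (mu : {sigma_finite_measure set (borel_rV R d) -> \bar R}).

Definition lebesgue_rV_succ : set (borel_rV R d.+1) -> \bar R :=
  pushforward (lebesgue_measure \x mu)%E (@cons_rV d).

Let lebesgue_rV_succ0 : lebesgue_rV_succ set0 = 0%E.
Proof. by rewrite /lebesgue_rV_succ /pushforward preimage_set0 measure0. Qed.

Let lebesgue_rV_succ_ge0 A : (0 <= lebesgue_rV_succ A)%E.
Proof. by rewrite /lebesgue_rV_succ /pushforward measure_ge0. Qed.

Let lebesgue_rV_succ_semi_sigma_additive :
  semi_sigma_additive lebesgue_rV_succ.
Proof.
rewrite /lebesgue_rV_succ; apply: measure_semi_sigma_additive.
exact: measurable_cons_rV.
Qed.

HB.instance Definition _ := isMeasure.Build _ _ _ lebesgue_rV_succ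
  lebesgue_rV_succ0 lebesgue_rV_succ_ge0 lebesgue_rV_succ_semi_sigma_additive.

Let lebesgue_rV_succ_sigma_finite : sigma_finite setT lebesgue_rV_succ.
Proof.
have /sigma_finiteP[F [TF ndF Foo]] := sigma_finiteT (@lebesgue_measure R).
have /sigma_finiteP[G [TG ndG Goo]] := sigma_finiteT mu.
exists (fun n => @behead_rV d @^-1` (F n `*` G n)).
  rewrite -preimage_bigcup -[LHS](preimage_setT (@behead_rV d)); congr preimage.
  rewrite -setXTT TF TG predeqE => -[x y]; split.
    move=> [/= [n _ Fnx] [k _ Gky]]; exists (maxn n k) => //; split.
    - by move: x Fnx; exact/subsetPset/ndF/leq_maxl.
    - by move: y Gky; exact/subsetPset/ndG/leq_maxr.
  by move=> [n _ []/= ? ?]; split; exists n.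
move=> n; have [mFn Fnoo] := Foo n; have [mGn Gnoo] := Goo n; split.
  rewrite -[X in measurable X]setTI; apply: measurable_behead_rV => //.
  exact: measurableX.
rewrite /lebesgue_rV_succ /pushforward -comp_preimage.
rewrite (_ : _ \o _ = id); last by apply/funext => x; exact: cons_rVK.
by rewrite preimage_id product_measure1E// lte_mul_pinfty// ge0_fin_numE.
Qed.

HB.instance Definition _ := Measure_isSigmaFinite.Build _ _ _ lebesgue_rV_succ
  lebesgue_rV_succ_sigma_finite.

End lebesgue_rV_succ.

(* d-fold product of the one-dimensional Lebesgue measure, transported to row
   vectors; lebesgue_rV_box below computes it on boxes. *)
Fixpoint lebesgue_rV (d : nat) :
    {sigma_finite_measure set (borel_rV R d) -> \bar R} :=
  match d with
  | 0 => \d_ ((0 : 'rV[R]_0) : borel_rV R 0)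
  | d'.+1 => lebesgue_rV_succ (lebesgue_rV d')
  end.

Lemma measurable_box_rV (d : nat) (A : 'I_d -> set R) :
    (forall i, measurable (A i)) ->
  measurable ([set v : 'rV[R]_d | forall i, A i (v 0 i)] : set (borel_rV R d)).
Proof.
move=> mA; rewrite (_ : mkset _ = \bigcap_(i in [set: 'I_d])
    ((fun v : 'rV[R]_d => v 0 i) @^-1` A i)); last first.
  by apply/seteqP; split => v /= vA; [move=> i _|move=> i]; exact: vA.
apply: (@fin_bigcap_measurable _ (borel_rV R d)) => [|i _].
  exact: finite_finset.
rewrite -[X in measurable X]setTI; apply: measurable_coord_rV => //.
exact: mA.
Qed.

Lemma lebesgue_rV_box (d : nat) (A : 'I_d -> set R) :
    (forall i, measurable (A i)) ->
  lebesgue_rV d [set v : 'rV[R]_d | forall i, A i (v 0 i)] =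
  (\prod_(i < d) lebesgue_measure (A i))%E.
Proof.
elim: d A => [|d IH] A mA.
  rewrite big_ord0 /= diracE mem_set//.
  by case.
rewrite big_ord_recl -(IH (fun i => A (lift ord0 i)))//.
set B := [set v : 'rV[R]_d | forall i, A (lift ord0 i) (v 0 i)].
have mB : measurable (B : set (borel_rV R d)).
  by apply: (@measurable_box_rV d (fun i => A (lift ord0 i))) => i; exact: mA.
transitivity ((lebesgue_measure \x lebesgue_rV d)%E (A ord0 `*` B)); last first.
  exact: (product_measure1E lebesgue_measure (lebesgue_rV d) (mA ord0) mB).
rewrite /= /lebesgue_rV_succ /pushforward; congr product_measure1.
apply/seteqP; split => [[x v] xv|[x v] [/= Ax Av] i].
  split=> [|i]; first by have := xv ord0; rewrite mxE unlift_none.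
  by have := xv (lift ord0 i); rewrite mxE liftK.
by rewrite mxE; case: unliftP => [j ->|->].
Qed.

End lebesgue_measure_rV.

Section L2.
Variables (R : realType) (d : nat) (Omega : set 'rV[R]_d).
Hypothesis oOmega : open Omega.

Definition lebesgue_on : {measure set (borel_rV R d) -> \bar R} :=
  mrestr (lebesgue_rV R d) (open_measurable_rV oOmega).

(* Elements are representatives: Borel functions on the whole of R^d that are
   square integrable for the Lebesgue measure restricted to Omega, so their
   values outside Omega are irrelevant. The type is an lmodType over R. *)
Definition L2 : lmodType R := LfunType lebesgue_on (lee1n 2).

Definition L2dot (f g : L2) : R :=
  \int[lebesgue_on]_x ((f : LfunType lebesgue_on (lee1n 2)) x *
                       (g : LfunType lebesgue_on (lee1n 2)) x).

Definition L2norm (f : L2) : R :=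
  fine ('N[lebesgue_on]_(2%:E)
    [EFin \o (f : LfunType lebesgue_on (lee1n 2))])%E.

End L2.

Section multistep_operators.
Variable R : realType.

Definition coefA (k q : nat) (s : R) : R :=
  match k, q with
  | 2, 2 => (2 * s + 1) / 2
  | 2, 1 => - (2 * s)
  | 2, 0 => (2 * s - 1) / 2
  | 3, 3 => (3 * s ^+ 2 + 6 * s + 2) / 6
  | 3, 2 => - ((9 * s ^+ 2 + 12 * s - 3) / 6)
  | 3, 1 => (9 * s ^+ 2 + 6 * s - 6) / 6
  | 3, 0 => - ((3 * s ^+ 2 - 1) / 6)
  | 4, 4 => (2 * s ^+ 3 + 9 * s ^+ 2 + 11 * s + 3) / 12
  | 4, 3 => (- (8 * s ^+ 3) - 30 * s ^+ 2 - 20 * s + 10) / 12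
  | 4, 2 => (12 * s ^+ 3 + 36 * s ^+ 2 + 6 * s - 18) / 12
  | 4, 1 => (- (8 * s ^+ 3) - 18 * s ^+ 2 + 4 * s + 6) / 12
  | 4, 0 => (2 * s ^+ 3 + 3 * s ^+ 2 - s - 1) / 12
  | _, _ => 0
  end.

Definition coefB (k q : nat) (s : R) : R :=
  match k, q with
  | 2, 1 => s
  | 2, 0 => - (s - 1)
  | 3, 2 => (s ^+ 2 + s) / 2
  | 3, 1 => - (s ^+ 2 - 1)
  | 3, 0 => (s ^+ 2 - s) / 2
  | 4, 3 => (s ^+ 3 + 3 * s ^+ 2 + 2 * s) / 6
  | 4, 2 => (- s ^+ 3 - 2 * s ^+ 2 + s + 2) / 2
  | 4, 1 => (s ^+ 3 + s ^+ 2 - 2 * s) / 2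
  | 4, 0 => (- s ^+ 3 + s) / 6
  | _, _ => 0
  end.

Definition coefC (k q : nat) (s : R) : R :=
  match k, q with
  | 2, 1 => s + 1
  | 2, 0 => - s
  | 3, 2 => (s ^+ 2 + 3 * s + 2) / 2
  | 3, 1 => - (s ^+ 2 + 2 * s)
  | 3, 0 => (s ^+ 2 + s) / 2
  | 4, 3 => (s ^+ 3 + 6 * s ^+ 2 + 11 * s + 6) / 6
  | 4, 2 => (- s ^+ 3 - 5 * s ^+ 2 - 6 * s) / 2
  | 4, 1 => (s ^+ 3 + 4 * s ^+ 2 + 3 * s) / 2
  | 4, 0 => (- s ^+ 3 - 3 * s ^+ 2 - 2 * s) / 6
  | _, _ => 0
  end.

Definition tau (k : nat) : R :=
  match k with
  | 2 => 0
  | 3 => 94 / 1000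
  | 4 => 275 / 1000
  | _ => 0
  end.

(* Sequences are indexed by int so that n - k + q is a genuine subtraction. *)
Variable V : lmodType R.
Implicit Types (phi : int -> V) (n : int).

Definition opA (k : nat) (s : R) phi n : V :=
  \sum_(q < k.+1) coefA k q s *: phi (n - k%:Z + q%:Z).

Definition opB (k : nat) (s : R) phi n : V :=
  \sum_(q < k) coefB k q s *: phi (n - k%:Z + 1 + q%:Z).

Definition opC (k : nat) (s : R) phi n : V :=
  \sum_(q < k) coefC k q s *: phi (n - k%:Z + 1 + q%:Z).

End multistep_operators.

Definition symposdef (R : realType) (k : nat) (H : 'M[R]_k) : Prop :=
  H^T = H /\ forall x : 'cV[R]_k, x != 0 -> 0 < (x^T *m H *m x) 0 0.

(* Main.v *)
Require Import Defs.
From mathcomp Require Import all_boot all_order all_algebra.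
From mathcomp Require Import all_classical all_reals all_analysis.
From mathcomp Require Import ring lra zify.
Import Order.TTheory GRing.Theory Num.Theory.
Import numFieldNormedType.Exports.
Local Open Scope classical_set_scope.
Local Open Scope ring_scope.
Set Implicit Arguments.
Unset Strict Implicit.

(** The identity is the discrete analogue of an energy balance: the quadratic
form H is an energy stored in a window of k consecutive terms, the product of
A with B + tau C is the energy supplied while the window moves by one step, and
the square of the combination with coefficients theta is what is dissipated.
Both sides are quadratic in the k + 1 vectors of a window, so everything reduces
to the symmetric array S of coefficients of (a.x)(b.x) - (c.x)^2, where a and b
are the coefficients of A and of B + tau C, and c those of theta.

S is a difference of two shifted copies of an array H exactly when all its
diagonals sum to zero ([pairing_storage]); then H is minus the sum of S up each
diagonal ([storage]). The condition on the diagonals says that c(z) is a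
spectral factor: |c(z)|^2 = Re (a(z) conj(b(z))) on the unit circle. With
u = 1 - cos w, the right-hand side is u times a polynomial P(u), of degree k - 1
at most, with coefficients depending on s. For k = 2 it is s (2 s - 1) u. For
k = 3 and k = 4 the values of tau make it positive for all u >= 0
([spectrum3_gt0], [spectrum4_gt0]), by a small margin: as s grows, u is to be
compared with s^-2 and the rescaled polynomials nearly have a double root.
Positivity gives the factor c: a negative root of P splits off when P is a
cubic ([cubic_split]), and the remaining quadratic polynomial has an explicit
factor ([quadratic_factor]).

The factor c involves radicals of polynomials in s, so H is not shown to be
positive definite by computing minors. The argument ([storage_posform]) only
uses that b is a Schur polynomial and is coprime to a. Let P be the Schur-Cohn
form of b: it is positive definite, and it is itself a storage, for the supply
(b.x)^2 and the dissipation (b'.x)^2 with b' the reversal of b. If H is not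
positive definite, then for some mu >= 0 the form W = H + mu P is positive
semidefinite and singular ([singular_pencil]). Extend a window of its kernel by
the term that makes b.x vanish. The balances of H and P show that W does not
increase, so the next window is in the kernel again, and first-order
optimality of W in the new term gives a.x = 0 as well. Iterating yields a
nonzero sequence annihilated by a and by b, against coprimality.

What is left are inequalities between polynomials in s: the Schur-Cohn
conditions ([scheme_schur]) and the nonvanishing of a Bezout determinant
([scheme_no_common_solution]). In the variable t = s - 1 >= 0 all coefficients
have the same sign. *)

(** * The inner product of L2 *)

Section L2_inner_product.
Context (R : realType) (d : nat) (Omega : set 'rV[R]_d) (oOmega : open Omega).
Implicit Types f g h : L2 oOmega.

Lemma L2_mul_integrable f g :
  (lebesgue_on oOmega).-integrable setT (EFin \o
    (fun x => (f : LfunType (lebesgue_on oOmega) (lee1n 2)) x *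
              (g : LfunType (lebesgue_on oOmega) (lee1n 2)) x)).
Proof. by apply/Lfun1_integrable/Lfun2_mul_Lfun1; exact: LfunP. Qed.

Lemma L2dotC f g : L2dot f g = L2dot g f.
Proof. by apply: eq_Rintegral => x _; rewrite mulrC. Qed.

Lemma L2dotDl f g h : L2dot (f + g) h = L2dot f h + L2dot g h.
Proof.
rewrite /L2dot -RintegralD//; try exact: L2_mul_integrable.
by apply: eq_Rintegral => x _; rewrite -mulrDl.
Qed.

Lemma L2dotZl c f g : L2dot (c *: f) g = c * L2dot f g.
Proof.
rewrite /L2dot -RintegralZl//; try exact: L2_mul_integrable.
by apply: eq_Rintegral => x _; rewrite mulrA.
Qed.

Lemma L2normE f : L2norm f ^+ 2 = L2dot f f.
Proof.
rewrite /L2norm /L2dot /Rintegral.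
set F := (f : LfunType (lebesgue_on oOmega) (lee1n 2)).
have fN : ('N[lebesgue_on oOmega]_(2%:E)[EFin \o F])%E \is a fin_num.
  have := LfunP F; rewrite inE => /andP[_]; rewrite inE /= /finite_norm => h.
  by rewrite ge0_fin_numE// Lnorm_ge0.
have -> : (\int[lebesgue_on oOmega]_x (F x * F x)%:E =
   'N[lebesgue_on oOmega]_(2%:E)[EFin \o F] `^ 2)%E.
  rewrite poweR_Lnorm//; apply: eq_integral => x _ /=.
  by rewrite powR_mulrn// real_normK ?num_real// expr2.
rewrite -(fineK fN) poweR_EFin /= powR_mulrn//.
by rewrite fine_ge0// Lnorm_ge0.
Qed.

End L2_inner_product.

(** * Quadratic forms on windows of a sequence *)

Definition pairing (R : realFieldType) (S : nat -> nat -> R) (k : nat)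
    (G : nat -> nat -> R) : R :=
  \sum_(i < k) \sum_(j < k) S i j * G i j.

Definition qform (R : realFieldType) (S : nat -> nat -> R) (k : nat)
    (x : nat -> R) : R := pairing S k (fun i j => x i * x j).

Definition lform (R : realFieldType) (a : nat -> R) (k : nat) (x : nat -> R) : R :=
  \sum_(i < k.+1) a i * x i.

Lemma lformM (R : realFieldType) (a b : nat -> R) k x :
  lform a k x * lform b k x = qform (fun i j => a i * b j) k.+1 x.
Proof.
rewrite /lform /qform /pairing mulr_suml; apply: eq_bigr => i _.
by rewrite mulr_sumr; apply: eq_bigr => j _; ring.
Qed.

Lemma qformZ (R : realFieldType) (M : nat -> nat -> R) k c (x : nat -> R) :
  qform M k (fun i => c * x i) = c ^+ 2 * qform M k x.
Proof.
rewrite /qform /pairing mulr_sumr; apply: eq_bigr => i _.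
by rewrite mulr_sumr; apply: eq_bigr => j _; ring.
Qed.

Lemma eq_qform (R : realFieldType) (M : nat -> nat -> R) k (x y : nat -> R) :
  (forall i, (i < k)%N -> x i = y i) -> qform M k x = qform M k y.
Proof.
move=> xy; apply: eq_bigr => i _; apply: eq_bigr => j _.
by rewrite !xy.
Qed.

Lemma eq_lform (R : realFieldType) (a : nat -> R) k (x y : nat -> R) :
  (forall i, (i <= k)%N -> x i = y i) -> lform a k x = lform a k y.
Proof. by move=> xy; apply: eq_bigr => i _; rewrite xy// -ltnS. Qed.

Lemma pairing_swap (R : realFieldType) (S G : nat -> nat -> R) k :
  (forall i j, G i j = G j i) ->
  pairing S k G = pairing (fun i j => S j i) k G.
Proof.
move=> sG; rewrite /pairing exchange_big; apply: eq_bigr => i _.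
by apply: eq_bigr => j _; rewrite sG.
Qed.

Definition posform (R : realFieldType) (M : nat -> nat -> R) (k : nat) : Prop :=
  forall x : nat -> R, (exists2 i, (i < k)%N & x i != 0) -> 0 < qform M k x.

Lemma posform_of_definite (R : realFieldType) (M : nat -> nat -> R) k :
  (forall x, qform M k x <= 0 -> forall i, (i < k)%N -> x i = 0) ->
  posform M k.
Proof.
move=> h x [i ik]; apply: contraNT; rewrite -leNgt => /h/(_ i ik) ->.
by rewrite eqxx.
Qed.

Lemma posform_symposdef (R : realType) (M : nat -> nat -> R) k :
  (forall i j, M i j = M j i) -> posform M k ->
  symposdef (\matrix_(i < k, j < k) M i j).
Proof.
move=> sM pM; split=> [|x x0]; first by apply/matrixP => i j; rewrite !mxE.
pose y i : R := if insub i is Some j then x j 0 else 0.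
have yE (i : 'I_k) : y i = x i 0 by rewrite /y valK.
have /pM : exists2 i, (i < k)%N & y i != 0.
  have [i xi|x_eq0] := pickP (fun i => x i 0 != 0).
    by exists i; rewrite ?yE.
  by case/eqP: x0; apply/colP => i; rewrite mxE; apply/eqP/negbFE/x_eq0.
congr (0 < _); rewrite /qform /pairing exchange_big mxE.
apply: eq_bigr => j _; rewrite mxE mulr_suml; apply: eq_bigr => i _.
by rewrite !mxE !yE; ring.
Qed.

(** * Storage arrays *)

(** The only candidate H for S i j = H (i - 1) (j - 1) - H i j, where H is zero
outside of the nonnegative indices. *)
Definition storage (R : realFieldType) (S : nat -> nat -> R) (i j : nat) : R :=
  - \sum_(t < (minn i j).+1) S (i - t)%N (j - t)%N.

(** The diagonals of the array S, restricted to indices at most k, sum to zero.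
This is what makes [storage S] vanish when one index is k and the other is at
most k. *)
Definition balanced (R : realFieldType) (S : nat -> nat -> R) (k : nat) : Prop :=
  forall j, (j <= k)%N -> \sum_(i < (k - j).+1) S i (i + j)%N = 0.

Lemma storageS (R : realFieldType) (S : nat -> nat -> R) i j :
  storage S i.+1 j.+1 = storage S i j - S i.+1 j.+1.
Proof.
rewrite /storage minnSS [in LHS]big_ord_recl /= !subn0 opprD addrC.
by congr (- _ - _); apply: eq_bigr => t _; rewrite !subSS.
Qed.

Lemma storage_sym (R : realFieldType) (S : nat -> nat -> R) :
  (forall i j, S i j = S j i) -> forall i j, storage S i j = storage S j i.
Proof.
by move=> sS i j; rewrite /storage minnC; congr (- _); apply: eq_bigr.
Qed.

Lemma storage_last (R : realFieldType) (S : nat -> nat -> R) k i :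
  balanced S k -> (i <= k)%N -> storage S i k = 0.
Proof.
move=> bS ik; rewrite /storage (minn_idPl ik); apply/eqP; rewrite oppr_eq0.
apply/eqP; rewrite -[RHS](bS (k - i)%N (leq_subr _ _)) (subKn ik).
rewrite [LHS](reindex_inj rev_ord_inj) /=; apply: eq_bigr => t _.
have ti : (t <= i)%N by rewrite -ltnS.
by rewrite !subSS subKn// subnA// addnC.
Qed.

(** The array G of inner products stands for the window: its shift by one index
along both axes is the array of the next window. No boundary
terms appear, because H vanishes on both sides just outside of its range of
indices. *)
Lemma pairing_storage (R : realFieldType) (S G : nat -> nat -> R) k :
    (forall i j, S i j = S j i) -> balanced S k ->
  pairing S k.+1 G =
  pairing (storage S) k (fun i j => G i.+1 j.+1) - pairing (storage S) k G.
Proof.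
move=> sS bS.
pose T (i j : nat) : R := if (i, j) is (i'.+1, j'.+1) then storage S i' j' else 0.
have TE i j : S i j = T i j - storage S i j.
  case: i j => [|i] [|j]; rewrite /T.
  - by rewrite /storage big_ord1 sub0r opprK.
  - by rewrite /storage min0n big_ord1 sub0r opprK.
  - by rewrite /storage minn0 big_ord1 sub0r opprK.
  - by rewrite storageS; ring.
have -> : pairing S k.+1 G = pairing T k.+1 G - pairing (storage S) k.+1 G.
  rewrite /pairing -sumrB; apply: eq_bigr => i _; rewrite -sumrB.
  by apply: eq_bigr => j _; rewrite TE mulrBl.
congr (_ - _).
  rewrite /pairing big_ord_recl big1 ?add0r; last by move=> j _; rewrite mul0r.
  by apply: eq_bigr => i _; rewrite big_ord_recl mul0r add0r.
rewrite /pairing big_ord_recr /= [X in _ + X]big1 ?addr0; last first.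
  by move=> j _; rewrite storage_sym// storage_last ?mul0r// -ltnS.
apply: eq_bigr => i _; rewrite big_ord_recr /=.
by rewrite storage_last ?mul0r ?addr0// ltnW.
Qed.

(** The symmetric array of the quadratic form (a.x)(b.x) - (c.x)^2. *)
Definition supply (R : realFieldType) (a b c : nat -> R) (i j : nat) : R :=
  (a i * b j + a j * b i) / 2 - c i * c j.

Lemma supply_sym (R : realFieldType) (a b c : nat -> R) i j :
  supply a b c i j = supply a b c j i.
Proof. by rewrite /supply; ring. Qed.

Lemma pairing_supply (R : realFieldType) (a b c : nat -> R) k G :
    (forall i j, G i j = G j i) ->
  pairing (supply a b c) k G =
  pairing (fun i j => a i * b j) k G - pairing (fun i j => c i * c j) k G.
Proof.
move=> sG; set AB := pairing (fun i j => a i * b j) k G.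
have -> : AB = (AB + pairing (fun i j => a j * b i) k G) / 2.
  by rewrite /AB (pairing_swap _ _ sG); field.
rewrite /AB /pairing -big_split /= mulr_suml -sumrB; apply: eq_bigr => i _.
rewrite -big_split /= mulr_suml -sumrB; apply: eq_bigr => j _.
by rewrite /supply; ring.
Qed.

Lemma storage_balance (R : realFieldType) (a b c : nat -> R) k (x : nat -> R) :
    balanced (supply a b c) k ->
  qform (storage (supply a b c)) k (fun i => x i.+1) =
  qform (storage (supply a b c)) k x +
  lform a k x * lform b k x - lform c k x ^+ 2.
Proof.
move=> bS; rewrite expr2 !lformM -addrA -pairing_supply; last first.
  by move=> i j; rewrite mulrC.
by rewrite (pairing_storage _ (supply_sym a b c))// /qform subrKC.
Qed.

(** * Positive definiteness of a storage *)

(** Take for - mu the minimum of M / N, which is attained on the unit sphere. *)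
Lemma singular_pencil (R : realType) (M N : nat -> nat -> R) (k : nat) :
    posform N k -> ~ posform M k ->
  exists mu : R, [/\ 0 <= mu,
    forall x, 0 <= qform M k x + mu * qform N k x &
    exists2 x, (exists2 i, (i < k)%N & x i != 0) &
      qform M k x + mu * qform N k x = 0].
Proof.
move=> N0 /existsNP[x0 /not_implyP[x0nz /negP]]; rewrite -leNgt => Mx0.
pose ext (v : 'rV[R]_k) (i : nat) : R := if insub i is Some j then v 0 j else 0.
have extE v (i : 'I_k) : ext v i = v 0 i by rewrite /ext valK.
have ext_neq0 v : v != 0 -> exists2 i, (i < k)%N & ext v i != 0.
  apply: contraNP => /forall2NP h; apply/eqP/rowP => i; rewrite mxE.
  by case: (h i) => [/(_ (ltn_ord i))//|/negP]; rewrite extE negbK => /eqP.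
pose f (v : 'rV[R]_k) := qform M k (ext v) / qform N k (ext v).
pose A := [set v : 'rV[R]_k | `|v| = 1].
have ccont (P : nat -> nat -> R) : continuous (fun v => qform P k (ext v)).
  move=> v; rewrite /continuous_at /qform /pairing.
  apply: (cvg_big add_continuous (F := nbhs v)) => i _.
  apply: (cvg_big add_continuous (F := nbhs v)) => j _.
  under eq_cvg do rewrite !extE.
  rewrite !extE; apply: cvgM; first exact: cvg_cst.
  by apply: cvgM; exact: coord_continuous.
have A0 v : A v -> 0 < qform N k (ext v).
  move=> Av; apply/N0/ext_neq0; apply: contra_eq_neq Av => ->.
  by rewrite normr0 eq_sym oner_neq0.
have fcont : {within A, continuous f}.
  apply: continuous_in_subspaceT => v /set_mem Av.
  apply: (@continuousM _ _ (fun w => qform M k (ext w))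
    (fun w => (qform N k (ext w))^-1)); first exact: ccont.
  by apply: continuousV; [exact/lt0r_neq0/A0|exact: ccont].
have Acompact : compact A.
  apply: bounded_closed_compact.
    by exists 1; split => // e e1 v /= ->; exact: ltW.
  rewrite (_ : A = Num.norm @^-1` [set 1]) //.
  by apply: preimage_closed => [v _|]; [exact: norm_continuous|exact: closed_eq].
pose unit_of (x : nat -> R) : 'rV[R]_k :=
  `|\row_(i < k) x i|^-1 *: \row_(i < k) x i.
have row_neq0 (x : nat -> R) : (exists2 i, (i < k)%N & x i != 0) -> `|\row_(i < k) x i| != 0.
  move=> [i ik xi]; rewrite normr_eq0; apply: contraNN xi => /eqP/rowP.
  by move=> /(_ (Ordinal ik)); rewrite !mxE /= => ->.
have unitA (x : nat -> R) : (exists2 i, (i < k)%N & x i != 0) -> A (unit_of x).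
  move=> /row_neq0 xn; rewrite /A /= /unit_of normrZ normfV normr_id mulVf//.
have unitE P x : qform P k (ext (unit_of x)) =
    `|\row_(i < k) x i| ^- 2 * qform P k x.
  rewrite -exprVn -qformZ; apply: eq_qform => i ik.
  by rewrite (extE _ (Ordinal ik)) !mxE.
have An0 : A !=set0 by exists (unit_of x0); exact: unitA.
have [c /set_mem cA cmin] := EVT_min_rV An0 Acompact fcont.
have fle (x : nat -> R) : (exists2 i, (i < k)%N & x i != 0) -> f c * qform N k x <= qform M k x.
  move=> xnz; rewrite -ler_pdivlMr ?N0//.
  have := cmin _ (mem_set (unitA _ xnz)); rewrite /f !unitE.
  by rewrite -mulf_div mulfV ?mul1r// invr_neq0// expf_neq0// row_neq0.
exists (- f c); split.
- rewrite oppr_ge0 -(pmulr_lle0 _ (N0 _ x0nz)); exact: le_trans (fle _ x0nz) Mx0.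
- move=> x; rewrite mulNr subr_ge0.
  case: (pselect (exists2 i, (i < k)%N & x i != 0)) => [/fle//|xz].
  have x00 i : (i < k)%N -> x i = 0 * x i.
    move=> ik; rewrite mul0r; apply/eqP/negPn/negP => xi.
    by apply: xz; exists i.
  by rewrite !(eq_qform _ x00) !qformZ expr0n /= !mul0r mulr0.
exists (ext c).
  apply: ext_neq0; apply: contra_eq_neq cA => ->.
  by rewrite normr0 eq_sym oner_neq0.
by rewrite mulNr divfK ?subrr// lt0r_neq0// A0.
Qed.

(** The Schur-Cohn form of b is [storage (schur_cohn b k)]: the dissipated term
is the reversal of b, which has the modulus of b on the unit circle. *)
Definition schur_cohn (R : realFieldType) (b : nat -> R) (k : nat) :=
  supply b b (fun i => b (k - i)%N).

Lemma schur_cohn_balanced (R : realFieldType) (b : nat -> R) k :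
  balanced (schur_cohn b k) k.
Proof.
move=> j jk; rewrite /schur_cohn /supply sumrB.
rewrite [X in _ - X](reindex_inj rev_ord_inj) /= -sumrB big1// => i _.
have ij : (i <= k - j)%N by rewrite -ltnS.
have kE : (k = (k - j - i) + i + j)%N by rewrite subnK// subnK.
have -> : (k - ((k - j).+1 - i.+1) = i + j)%N by rewrite subSS; lia.
have -> : (k - ((k - j).+1 - i.+1 + j) = i)%N by rewrite subSS; lia.
by field.
Qed.

(** Coprimality of the polynomials f and g, in terms of the sequences that they
annihilate as difference operators. *)
Definition no_common_solution (R : realFieldType) (f g : nat -> R) (k : nat) : Prop :=
  forall y : nat -> R,
    (forall n, lform f k (fun i => y (n + i)%N) = 0) ->
    (forall n, lform g k (fun i => y (n + i)%N) = 0) ->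
  forall n, y n = 0.

Lemma linear_coef_eq0 (R : realFieldType) (p q : R) :
  (forall t, 0 <= t * p + t ^+ 2 * q) -> p = 0.
Proof.
(* Evaluate at t = - p / D, small enough for the linear term to dominate. *)
move=> h; pose D := 1 + `|q|.
have D0 : 0 < D by rewrite /D ltr_pwDl.
have qD : q <= D - 1 by rewrite /D addrC addKr ler_norm.
have := h (- p / D).
have -> : - p / D * p + (- p / D) ^+ 2 * q = (p / D) ^+ 2 * (q - D).
  by field; rewrite lt0r_neq0.
rewrite nmulr_lge0; last by lra.
rewrite real_exprn_even_le0 ?num_real//= mulf_eq0 invr_eq0 (gt_eqF D0) orbF.
by move/eqP.
Qed.

(** The kernel of a singular positive semidefinite combination of the storage
and of the Schur-Cohn form is propagated by the recurrence b.x = 0, and a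
vanishes along it; coprimality leaves only zero. *)
Lemma storage_posform (R : realType) (k : nat) (a b c : nat -> R) :
    balanced (supply a b c) k -> b k != 0 ->
    posform (storage (schur_cohn b k)) k -> no_common_solution a b k ->
  posform (storage (supply a b c)) k.
Proof.
have bP := @schur_cohn_balanced _ b k; rewrite /schur_cohn in bP *.
set l := fun i => b (k - i)%N in bP *.
move=> bV bk0 P0 coprime_ab; apply: contrapT.
move=> /(singular_pencil P0)[mu [mu0 W0 [x xnz Wx]]].
set V := qform (storage (supply a b c)) k in W0 Wx.
set P := qform (storage (supply b b l)) k in W0 Wx.
have k0 : (0 < k)%N by case: xnz => i; case: (k).
pose fill (y : nat -> R) i :=
  if i == k then - (\sum_(j < k) b j * y j) / b k else y i.
pose next y i := fill y i.+1.
have fillE y i : (i < k)%N -> fill y i = y i.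
  by rewrite /fill => ik; rewrite ltn_eqF.
have b_fill y : lform b k (fill y) = 0.
  rewrite /lform big_ord_recr /= {2}/fill eqxx mulrCA mulfV// mulr1.
  by under eq_bigr => i _ do rewrite fillE//; rewrite subrr.
have kernel y : V y + mu * P y = 0 ->
    V (next y) + mu * P (next y) = 0 /\ lform a k (fill y) = 0.
  move=> Wy.
  (* The window of y extended by an arbitrary term: t is its deviation from the
     one that makes b vanish. *)
  pose z t i := fill y i + t * (i == k)%:R.
  have lz v t : lform v k (z t) = lform v k (fill y) + t * v k.
    rewrite /lform /z; under eq_bigr do rewrite mulrDr.
    rewrite big_split /=; congr (_ + _).
    rewrite big_ord_recr /= eqxx big1 ?add0r ?mulr1 1?mulrC// => i _.
    by rewrite ltn_eqF// mulr0 mulr0.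
  have Wz t : V (fun i => z t i.+1) + mu * P (fun i => z t i.+1) =
      (lform a k (fill y) + t * a k) * (t * b k)
      - (lform c k (fill y) + t * c k) ^+ 2
      + mu * ((t * b k) ^+ 2 - (lform l k (fill y) + t * l k) ^+ 2).
    have zy M : qform M k (z t) = qform M k y.
      by apply: eq_qform => i ik; rewrite /z fillE// ltn_eqF// mulr0 addr0.
    rewrite /V /P !storage_balance// !zy !lz b_fill add0r.
    rewrite -[RHS]add0r -[in RHS]Wy /V /P; ring.
  have z0 : (fun i => z 0 i.+1) = next y.
    by apply/funext => i; rewrite /z mul0r addr0.
  have C2 : 0 <= lform c k (fill y) ^+ 2 by rewrite sqr_ge0.
  have L2 : 0 <= mu * lform l k (fill y) ^+ 2 by rewrite mulr_ge0 ?sqr_ge0.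
  have Wn : 0 <= V (next y) + mu * P (next y) by exact: W0.
  have WnE : V (next y) + mu * P (next y) =
    - lform c k (fill y) ^+ 2 - mu * lform l k (fill y) ^+ 2.
    by rewrite -z0 Wz; ring.
  have c0 : lform c k (fill y) = 0.
    by apply/eqP; rewrite -sqrf_eq0; apply/eqP; lra.
  have l0 : mu * lform l k (fill y) = 0.
    have : mu * lform l k (fill y) ^+ 2 = 0 by lra.
    by move/eqP; rewrite mulf_eq0 sqrf_eq0 -mulf_eq0 => /eqP.
  split; first lra.
  apply: (mulIf bk0); rewrite mul0r.
  apply: (@linear_coef_eq0 _ _
    (a k * b k - c k ^+ 2 + mu * (b k ^+ 2 - l k ^+ 2))) => t.
  have := W0 (fun i => z t i.+1); rewrite Wz c0.
  congr (0 <= _).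
  have -> : (lform l k (fill y) + t * l k) ^+ 2 = lform l k (fill y) *
    (lform l k (fill y) + 2 * t * l k) + t ^+ 2 * l k ^+ 2 by ring.
  rewrite mulrBr [mu * (_ * _ + _)]mulrDr mulrA l0; ring.
pose xi n := iter n next x 0%N.
have Wxi n : V (iter n next x) + mu * P (iter n next x) = 0.
  by elim: n => // n /kernel[].
have xiE n i : (i < k)%N -> iter n next x i = xi (n + i)%N.
  elim: i n => [|i IH] n ik; first by rewrite addn0.
  by rewrite -addSnnS -IH 1?ltnW//= /next fillE.
have fillxi n i : (i <= k)%N -> fill (iter n next x) i = xi (n + i)%N.
  rewrite leq_eqVlt => /predU1P[->|ik]; last by rewrite fillE// xiE.
  by rewrite -(prednK k0) -addSnnS -xiE ?prednK//= /next prednK.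
have [i ik] := xnz; rewrite -[x]/(iter 0 next x) xiE// coprime_ab ?eqxx// => n.
- by rewrite -(eq_lform _ (fillxi n)); case: (kernel _ (Wxi n)).
- by rewrite -(eq_lform _ (fillxi n)).
Qed.

(** * Schur-Cohn criteria *)

Lemma sqr_le0_eq0 (R : realFieldType) (x : R) : x ^+ 2 <= 0 -> x = 0.
Proof. by rewrite real_exprn_even_le0 ?num_real//= => /eqP. Qed.

Lemma schur_cohn2_posform (R : realFieldType) (b : nat -> R) :
    b 0%N = 0 -> 0 < b 2%N ^+ 2 - b 1%N ^+ 2 ->
  posform (storage (schur_cohn b 2)) 2.
Proof.
move=> b0 p0; apply: posform_of_definite => x.
have -> : qform (storage (schur_cohn b 2)) 2 x =
   (b 2%N * x 0%N + b 1%N * x 1%N) ^+ 2 + (b 2%N ^+ 2 - b 1%N ^+ 2) * x 1%N ^+ 2.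
  rewrite /qform /pairing !big_ord_recr !big_ord0 /= /storage.
  rewrite !big_ord_recr !big_ord0 /= /schur_cohn /supply /= b0.
  by field.
move=> qx; have e0 := sqr_ge0 (b 2%N * x 0%N + b 1%N * x 1%N).
have x10 : x 1%N = 0.
  by apply: sqr_le0_eq0; rewrite -(pmulr_rle0 _ p0); lra.
have b2 : b 2%N != 0 by apply: contraTN p0 => /eqP ->; have := sqr_ge0 (b 1%N); lra.
case=> [|[|//]] _ //; apply: (mulfI b2); rewrite mulr0.
by apply: sqr_le0_eq0; move: qx; rewrite x10; lra.
Qed.

(** Since b 0 = 0, one square splits off and leaves the Schur-Cohn form of the
quadratic polynomial with coefficients b 1, b 2, b 3, which is diagonal in
x 1 + x 2 and x 1 - x 2. *)
Lemma schur_cohn3_posform (R : realFieldType) (b : nat -> R) : b 0%N = 0 ->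
    0 < b 3%N - b 1%N -> 0 < b 3%N + b 1%N + b 2%N ->
    0 < b 3%N + b 1%N - b 2%N ->
  posform (storage (schur_cohn b 3)) 3.
Proof.
move=> b0 d0 sp0 sm0; apply: posform_of_definite => x.
set ep := (b 3%N - b 1%N) * (b 3%N + b 1%N + b 2%N).
set em := (b 3%N - b 1%N) * (b 3%N + b 1%N - b 2%N).
have -> : qform (storage (schur_cohn b 3)) 3 x =
   (b 3%N * x 0%N + b 2%N * x 1%N + b 1%N * x 2%N) ^+ 2
  + ep / 2 * (x 1%N + x 2%N) ^+ 2 + em / 2 * (x 1%N - x 2%N) ^+ 2.
  rewrite /qform /pairing !big_ord_recr !big_ord0 /= /storage.
  rewrite !big_ord_recr !big_ord0 /= /schur_cohn /supply /= b0.
  by rewrite /ep /em; field.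
have ep0 : 0 < ep / 2 by rewrite divr_gt0// mulr_gt0.
have em0 : 0 < em / 2 by rewrite divr_gt0// mulr_gt0.
move=> qx; have e0 := sqr_ge0 (b 3%N * x 0%N + b 2%N * x 1%N + b 1%N * x 2%N).
have h1 : 0 <= ep / 2 * (x 1%N + x 2%N) ^+ 2 by rewrite pmulr_rge0// sqr_ge0.
have h2 : 0 <= em / 2 * (x 1%N - x 2%N) ^+ 2 by rewrite pmulr_rge0// sqr_ge0.
have s0 : x 1%N + x 2%N = 0 by apply: sqr_le0_eq0; rewrite -(pmulr_rle0 _ ep0); lra.
have t0 : x 1%N - x 2%N = 0 by apply: sqr_le0_eq0; rewrite -(pmulr_rle0 _ em0); lra.
have x10 : x 1%N = 0 by lra.
have x20 : x 2%N = 0 by lra.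
have b3 : b 3%N != 0 by rewrite gt_eqF//; lra.
case=> [|[|[|//]]] _ //; apply: (mulfI b3); rewrite mulr0.
by apply: sqr_le0_eq0; move: qx; rewrite x10 x20; lra.
Qed.

(** Once the square given by b 0 = 0 has split off, the remaining form in
x 1, x 2, x 3 is invariant under exchanging x 1 and x 3, so x 1 - x 3 decouples
from x 2 and x 1 + x 3, where the square is completed. *)
Lemma schur_cohn4_posform (R : realFieldType) (b : nat -> R) :
    let p := b 4%N ^+ 2 - b 1%N ^+ 2 in
    let q := b 4%N * b 3%N - b 1%N * b 2%N in
    let r := b 4%N * b 2%N - b 1%N * b 3%N in
    let m := p + b 3%N ^+ 2 - b 2%N ^+ 2 in
    b 0%N = 0 -> 0 < p - r -> 0 < p + r -> 2 * q ^+ 2 < (p + r) * m ->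
  posform (storage (schur_cohn b 4)) 4.
Proof.
move=> p q r m b0 pr_m pr_p det0; apply: posform_of_definite => x.
set y := x 1%N + x 3%N; set z := x 1%N - x 3%N.
have -> : qform (storage (schur_cohn b 4)) 4 x =
   (b 4%N * x 0%N + b 3%N * x 1%N + b 2%N * x 2%N + b 1%N * x 3%N) ^+ 2
  + (p - r) / 2 * z ^+ 2
  + ((p + r) * y + 2 * q * x 2%N) ^+ 2 / (2 * (p + r))
  + ((p + r) * m - 2 * q ^+ 2) / (p + r) * x 2%N ^+ 2.
  transitivity ((b 4%N * x 0%N + b 3%N * x 1%N + b 2%N * x 2%N + b 1%N * x 3%N) ^+ 2
    + (p - r) / 2 * z ^+ 2 + (p + r) / 2 * y ^+ 2
    + 2 * q * x 2%N * y + m * x 2%N ^+ 2); last first.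
    by field; rewrite gt_eqF.
  rewrite /qform /pairing !big_ord_recr !big_ord0 /= /storage.
  rewrite !big_ord_recr !big_ord0 /= /schur_cohn /supply /= b0.
  by rewrite /m /q /r /p /y /z; field.
have c1 : 0 < (p - r) / 2 by lra.
have c2 : 0 < (2 * (p + r))^-1 by rewrite invr_gt0; lra.
have c3 : 0 < ((p + r) * m - 2 * q ^+ 2) / (p + r).
  by rewrite divr_gt0// subr_gt0.
set e := _ + b 1%N * x 3%N; set w := _ + 2 * q * x 2%N => qx.
have h0 := sqr_ge0 e.
have h1 : 0 <= (p - r) / 2 * z ^+ 2 by rewrite pmulr_rge0// sqr_ge0.
have h2 : 0 <= w ^+ 2 / (2 * (p + r)) by rewrite pmulr_lge0// sqr_ge0.
have h3 : 0 <= ((p + r) * m - 2 * q ^+ 2) / (p + r) * x 2%N ^+ 2.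
  by rewrite pmulr_rge0// sqr_ge0.
have x20 : x 2%N = 0 by apply: sqr_le0_eq0; rewrite -(pmulr_rle0 _ c3); lra.
have z0 : z = 0 by apply: sqr_le0_eq0; rewrite -(pmulr_rle0 _ c1); lra.
have w0 : w = 0 by apply: sqr_le0_eq0; rewrite -(pmulr_lle0 _ c2); lra.
have y0 : y = 0.
  by apply: (mulfI (lt0r_neq0 pr_p)); rewrite mulr0 -w0 /w x20 mulr0 addr0.
have x10 : x 1%N = 0 by move: y0 z0; rewrite /y /z; lra.
have x30 : x 3%N = 0 by move: y0 z0; rewrite /y /z; lra.
have b4 : b 4%N != 0.
  apply/eqP => b40; have : 0 < p by lra.
  by rewrite /p b40; have := sqr_ge0 (b 1%N); lra.
case=> [|[|[|[|//]]]] _ //; apply: (mulfI b4); rewrite mulr0.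
by apply: sqr_le0_eq0; move: qx h0 h1 h2 h3; rewrite /e x10 x20 x30; lra.
Qed.

(** * Coprimality by Bezout determinants *)

(** Summation by parts: when a sums to zero, its partial sums are, up to sign,
the coefficients of the quotient of a by the difference operator. *)
Lemma abel_sum (R : realFieldType) (a xi : nat -> R) m :
  \sum_(i < m) - (\sum_(j < i.+1) a j) * (xi i.+1 - xi i) =
  \sum_(i < m) a i * xi i - (\sum_(j < m) a j) * xi m.
Proof.
elim: m => [|m IH]; first by rewrite !big_ord0 mul0r subr0.
rewrite big_ord_recr IH /= [\sum_(j < m.+1) a j]big_ord_recr.
by rewrite [\sum_(i < m.+1) a i * _]big_ord_recr /=; ring.
Qed.

(** The operator a is divisible by the difference operator and b by the shift.
Neither factor is shared: constants are not annihilated by b because its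
coefficients do not sum to zero, and the first term is recovered from the later
ones because a 0 is not zero. So the quotients are all that matters. *)
Lemma no_common_solutionS (R : realFieldType) (a b : nat -> R) k :
    \sum_(i < k.+2) a i = 0 -> b 0%N = 0 -> \sum_(i < k.+2) b i != 0 ->
    a 0%N != 0 ->
    no_common_solution (fun i => - \sum_(j < i.+1) a j) (fun i => b i.+1) k ->
  no_common_solution a b k.+1.
Proof.
move=> a1 b0 b1 a0 coprime_fb xi axi bxi.
have dxi n : xi n.+2 - xi n.+1 = 0.
  apply: (coprime_fb (fun n => xi n.+2 - xi n.+1)) n => n.
    rewrite /lform -[RHS](axi n.+1) /lform.
    have := abel_sum a (fun i => xi (n.+1 + i)%N) k.+1.
    under eq_bigr do rewrite addnS addSn.
    move=> ->; rewrite [in RHS]big_ord_recr /=.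
    move: a1; rewrite big_ord_recr /= => /eqP; rewrite addr_eq0 => /eqP ->.
    by rewrite mulNr opprK.
  rewrite /lform; under eq_bigr do rewrite mulrBr.
  rewrite sumrB.
  have bE m : \sum_(i < k.+1) b i.+1 * xi (m + i).+1 = 0.
    rewrite -[RHS](bxi m) /lform [RHS]big_ord_recl b0 mul0r add0r.
    by apply: eq_bigr => i _; rewrite addnS.
  by rewrite -[RHS](subrr 0); congr (_ - _); [exact: (bE n.+1)|exact: bE].
have xi_const n : xi n.+1 = xi 1%N.
  by elim: n => // n <-; apply/eqP; rewrite -subr_eq0 dxi.
have xi1 : xi 1%N = 0.
  apply: (mulfI b1); rewrite mulr0 -[RHS](bxi 1%N) /lform mulr_suml.
  by apply: eq_bigr => i _; rewrite xi_const.
case=> [|n]; last by rewrite xi_const.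
apply: (mulfI a0); rewrite mulr0 -[RHS](axi 0%N) /lform big_ord_recl.
by rewrite [X in _ + X]big1 ?addr0// => i _; rewrite /= add0n xi_const xi1 mulr0.
Qed.

Definition minor (R : realFieldType) (f g : nat -> R) (i j : nat) : R :=
  f i * g j - g i * f j.

Lemma bezout1 (R : realFieldType) (f g : nat -> R) :
  minor f g 1 0 != 0 -> no_common_solution f g 1.
Proof.
move=> det0 y fy gy n; apply: (mulfI det0); rewrite mulr0.
transitivity (f 1%N * lform g 1 (fun i => y (n + i)%N) -
  g 1%N * lform f 1 (fun i => y (n + i)%N)).
  by rewrite /lform /minor !big_ord_recr !big_ord0 /= addn0; ring.
by rewrite fy gy !mulr0 subr0.
Qed.

(** The rows of the Bezout matrix are combinations of f, g and their shifts in
which the top terms cancel; Cramer gives y n = 0. *)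
Lemma bezout2 (R : realFieldType) (f g : nat -> R) :
  minor f g 2 0 ^+ 2 - minor f g 2 1 * minor f g 1 0 != 0 -> no_common_solution f g 2.
Proof.
move=> det0 y fy gy n; apply: (mulfI det0); rewrite mulr0.
pose F m := lform f 2 (fun i => y (m + i)%N).
pose G m := lform g 2 (fun i => y (m + i)%N).
have row0 : minor f g 2 0 * y n + minor f g 2 1 * y n.+1 = f 2%N * G n - g 2%N * F n.
  by rewrite /F /G /lform !big_ord_recr !big_ord0 /= addn0 addn1 /minor; ring.
have row1 : minor f g 1 0 * y n + minor f g 2 0 * y n.+1 =
  f 1%N * G n - g 1%N * F n + (f 2%N * G n.+1 - g 2%N * F n.+1).
  rewrite /F /G /lform !big_ord_recr !big_ord0 /= !addSn !addn0 addn1 addn2 /minor.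
  by ring.
move: row0 row1; rewrite /F /G !fy !gy !mulr0 !subr0 addr0 => row0 row1.
transitivity (minor f g 2 0 * (minor f g 2 0 * y n + minor f g 2 1 * y n.+1) -
  minor f g 2 1 * (minor f g 1 0 * y n + minor f g 2 0 * y n.+1)); first by ring.
by rewrite row0 row1 !mulr0 subr0.
Qed.

Lemma bezout3 (R : realFieldType) (f g : nat -> R) :
  minor f g 3 0 * ((minor f g 2 1 + minor f g 3 0) * minor f g 3 0 - minor f g 3 1 * minor f g 2 0)
  - minor f g 3 1 * (minor f g 2 0 * minor f g 3 0 - minor f g 3 1 * minor f g 1 0)
  + minor f g 3 2 * (minor f g 2 0 ^+ 2 - (minor f g 2 1 + minor f g 3 0) * minor f g 1 0) != 0 ->
  no_common_solution f g 3.
Proof.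
move=> det0 y fy gy n; apply: (mulfI det0); rewrite mulr0.
pose F m := lform f 3 (fun i => y (m + i)%N).
pose G m := lform g 3 (fun i => y (m + i)%N).
have row0 : minor f g 3 0 * y n + minor f g 3 1 * y n.+1 + minor f g 3 2 * y n.+2 =
    f 3%N * G n - g 3%N * F n.
  rewrite /F /G /lform !big_ord_recr !big_ord0 /= addn0 addn1 addn2 /minor.
  by ring.
have row1 : minor f g 2 0 * y n + (minor f g 2 1 + minor f g 3 0) * y n.+1 + minor f g 3 1 * y n.+2 =
    f 2%N * G n - g 2%N * F n + (f 3%N * G n.+1 - g 3%N * F n.+1).
  rewrite /F /G /lform !big_ord_recr !big_ord0 /= !addSn !addn0 !addn1 !addn2 addn3 /minor.
  by ring.
have row2 : minor f g 1 0 * y n + minor f g 2 0 * y n.+1 + minor f g 3 0 * y n.+2 =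
    f 1%N * G n - g 1%N * F n + (f 2%N * G n.+1 - g 2%N * F n.+1)
    + (f 3%N * G n.+2 - g 3%N * F n.+2).
  rewrite /F /G /lform !big_ord_recr !big_ord0 /= !addSn !addn0 !addn1 !addn2 !addn3 /minor.
  by ring.
move: row0 row1 row2; rewrite /F /G !fy !gy !mulr0 !subr0 !addr0 => row0 row1 row2.
transitivity (((minor f g 2 1 + minor f g 3 0) * minor f g 3 0 - minor f g 3 1 * minor f g 2 0) * 0
  - (minor f g 3 1 * minor f g 3 0 - minor f g 3 2 * minor f g 2 0) * 0
  + (minor f g 3 1 ^+ 2 - minor f g 3 2 * (minor f g 2 1 + minor f g 3 0)) * 0 : R).
  by rewrite -{1}row0 -{1}row1 -row2; ring.
by rewrite !mulr0 subr0 addr0.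
Qed.

(** * Spectral factorization *)

Definition lag (R : realFieldType) (a b : nat -> R) (k j : nat) : R :=
  \sum_(i < (k - j).+1) (a i * b (i + j)%N + a (i + j)%N * b i) / 2.

(** The coefficient of cos (j w) (halved when j is positive) in (1 - cos w)^n;
the index that would be -1 is 1, by parity. *)
Fixpoint cos_lag (R : realFieldType) (n j : nat) : R :=
  if n is m.+1 then
    cos_lag R m j - (cos_lag R m j.+1 + cos_lag R m (if j is i.+1 then i else 1%N)) / 2
  else (j == 0%N)%:R.

(** On the unit circle, the real part of a(z) conj(b(z)) is the polynomial f in
1 - cos w. *)
Definition has_spectrum (R : realFieldType) (a b : nat -> R) (k : nat)
    (f : nat -> R) : Prop :=
  forall j, (j <= k)%N -> lag a b k j =
    \sum_(n < k.+1) f n * cos_lag R n j.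

Lemma spectrum_balanced (R : realFieldType) (a b c f : nat -> R) k :
  has_spectrum a b k f -> has_spectrum c c k f -> balanced (supply a b c) k.
Proof.
move=> abf cf j jk; transitivity (lag a b k j - lag c c k j); last first.
  by rewrite abf// cf// subrr.
rewrite /lag -sumrB; apply: eq_bigr => i _.
by rewrite /supply; field.
Qed.

(** With u = 1 - cos w, this is |al + be z|^2 = rho + u. *)
Lemma linear_factor (R : rcfType) (rho : R) : 0 < rho ->
  exists al be : R, (al + be) ^+ 2 = rho /\ - (2 * al * be) = 1.
Proof.
move=> r0.
have s1 : Num.sqrt rho ^+ 2 = rho by rewrite sqr_sqrtr// ltW.
have s2 : Num.sqrt (rho + 2) ^+ 2 = rho + 2 by rewrite sqr_sqrtr//; lra.
exists ((Num.sqrt rho + Num.sqrt (rho + 2)) / 2),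
  ((Num.sqrt rho - Num.sqrt (rho + 2)) / 2); split.
  by rewrite -[RHS]s1; field.
transitivity ((Num.sqrt (rho + 2) ^+ 2 - Num.sqrt rho ^+ 2) / 2); first by field.
by rewrite s1 s2; field.
Qed.

(** The Fejer-Riesz theorem in degree two: q0 + q1 u + q2 u^2 is
|p0 + p1 z + p2 z^2|^2 with u = 1 - cos w. At u = 0 and u = 2, that is z = 1 and
z = -1, this fixes p0 + p2 + p1 and p0 + p2 - p1 up to signs, and q2 is
4 p0 p2, so p0 and p2 are the roots of a quadratic polynomial. Its discriminant
is, up to a positive factor, the value of q at a point of the interval. *)
Lemma quadratic_factor (R : rcfType) (q0 q1 q2 : R) :
    (forall u, 0 <= u <= 2 -> 0 < q0 + q1 * u + q2 * u ^+ 2) ->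
  exists p0 p1 p2 : R, [/\ q0 = (p0 + p1 + p2) ^+ 2,
    q1 = - (2 * p1 * (p0 + p2)) - 8 * p0 * p2 & q2 = 4 * p0 * p2].
Proof.
move=> Q0.
have l0 : 0 < q0 by have := Q0 0; rewrite lexx ler0n => /(_ isT); lra.
have l2 : 0 < q0 + 2 * q1 + 4 * q2.
  by have := Q0 2; rewrite lexx ler0n => /(_ isT); lra.
pose X := Num.sqrt q0; pose Y := Num.sqrt (q0 + 2 * q1 + 4 * q2).
have X0 : 0 < X by rewrite sqrtr_gt0.
have Y0 : 0 < Y by rewrite sqrtr_gt0.
have X2 : X ^+ 2 = q0 by rewrite sqr_sqrtr// ltW.
have Y2 : Y ^+ 2 = q0 + 2 * q1 + 4 * q2 by rewrite sqr_sqrtr// ltW.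
(* Evaluate at u = 2 X / (X + Y), where the two outer Bernstein terms of q are
   equal. *)
have disc : 0 <= (X + Y) ^+ 2 - 4 * q2.
  have XY0 : 0 < X + Y by rewrite addr_gt0.
  have : 0 < q0 + q1 * (2 * X / (X + Y)) + q2 * (2 * X / (X + Y)) ^+ 2.
    apply: Q0; rewrite ler_pdivrMr// ler_pdivlMr//; lra.
  have -> : q0 + q1 * (2 * X / (X + Y)) + q2 * (2 * X / (X + Y)) ^+ 2 =
      X * Y / (X + Y) ^+ 2 * ((X + Y) ^+ 2 - 4 * q2).
    have -> : q1 = (Y ^+ 2 - X ^+ 2 - 4 * q2) / 2 by rewrite Y2 X2; field.
    by rewrite -X2; field; rewrite gt_eqF.
  by rewrite pmulr_rgt0 ?divr_gt0 ?mulr_gt0 ?exprn_gt0// => /ltW.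
pose D := Num.sqrt ((X + Y) ^+ 2 - 4 * q2).
have D2 : D ^+ 2 = (X + Y) ^+ 2 - 4 * q2 by rewrite sqr_sqrtr.
have q2E : q2 = ((X + Y) ^+ 2 - D ^+ 2) / 4 by rewrite D2; field.
exists ((X + Y + D) / 4), ((X - Y) / 2), ((X + Y - D) / 4); split.
- by rewrite -X2; field.
- have -> : q1 = (Y ^+ 2 - X ^+ 2 - 4 * q2) / 2 by rewrite Y2 X2; field.
  by rewrite q2E; field.
- by rewrite q2E; field.
Qed.

Lemma cubic_split (R : rcfType) (f0 f1 f2 f3 : R) : 0 < f3 ->
    (forall u, 0 <= u -> 0 < f0 + f1 * u + f2 * u ^+ 2 + f3 * u ^+ 3) ->
  exists rho q0 q1 q2 : R, [/\ 0 < rho,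
    forall u, 0 <= u -> 0 < q0 + q1 * u + q2 * u ^+ 2 &
    [/\ f0 = rho * q0, f1 = q0 + rho * q1, f2 = q1 + rho * q2 & f3 = q2]].
Proof.
move=> f30 P0.
have f00 : 0 < f0 by have := P0 0 (lexx _); lra.
(* The Cauchy bound: the cubic is nonpositive at - t. *)
pose t := 1 + (`|f0| + `|f1| + `|f2|) / f3.
have t1 : 1 <= t by rewrite /t lerDl divr_ge0 ?addr_ge0// ltW.
have f3t : f3 * t = f3 + (`|f0| + `|f1| + `|f2|).
  by rewrite /t mulrDr mulr1 mulrCA mulfV ?mulr1// gt_eqF.
pose p : {poly R} := Poly [:: f0; f1; f2; f3].
have pE u : p.[u] = f0 + f1 * u + f2 * u ^+ 2 + f3 * u ^+ 3.
  by rewrite /p horner_Poly /=; ring.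
have pt : p.[- t] <= 0.
  rewrite pE.
  have -> : f0 + f1 * - t + f2 * (- t) ^+ 2 + f3 * (- t) ^+ 3 =
    f0 - f1 * t + f2 * t ^+ 2 - f3 * t * t ^+ 2 by ring.
  rewrite f3t.
  have tt : t <= t ^+ 2 by rewrite expr2 ler_peMl//; lra.
  have t2 : 1 <= t ^+ 2 by lra.
  have h0 : f0 <= `|f0| * t ^+ 2.
    by rewrite (le_trans (ler_norm _))// ler_peMr.
  have h1 : - f1 * t <= `|f1| * t ^+ 2.
    apply: (@le_trans _ _ (`|f1| * t)); last by rewrite ler_wpM2l.
    by rewrite ler_wpM2r ?(le_trans ler01)// -normrN ler_norm.
  have h2 : f2 * t ^+ 2 <= `|f2| * t ^+ 2.
    by rewrite ler_wpM2r ?ler_norm// (le_trans ler01).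
  have h3 : 0 <= f3 * t ^+ 2 by apply: mulr_ge0; lra.
  nra.
have [||r /andP[_ r0] /rootP] := @poly_ivt _ p (- t) 0.
- by lra.
- by rewrite pt pE; lra.
rewrite pE => pr.
have rneg : r < 0.
  rewrite lt_neqAle r0 andbT; apply: contra_eq_neq pr => ->.
  by rewrite gt_eqF// P0.
exists (- r), (f1 + r * (f2 + r * f3)), (f2 + r * f3), f3; split.
- by rewrite oppr_gt0.
- move=> u u0; have ur : 0 < u - r by lra.
  rewrite -(pmulr_rgt0 _ ur).
  have -> : (u - r) * (f1 + r * (f2 + r * f3) + (f2 + r * f3) * u + f3 * u ^+ 2)
    = (f0 + f1 * u + f2 * u ^+ 2 + f3 * u ^+ 3) -
      (f0 + f1 * r + f2 * r ^+ 2 + f3 * r ^+ 3) by ring.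
  by rewrite pr subr0 P0.
- split=> //; [|ring|ring].
  by apply/eqP; rewrite -subr_eq0; apply/eqP; rewrite -[RHS]pr; ring.
Qed.

Lemma spectral_factor2 (R : rcfType) (f : R) : 0 <= f ->
  exists c : nat -> R, has_spectrum c c 2 (nth 0 [:: 0; 0; f]).
Proof.
move=> f0; pose e := Num.sqrt (f / 4).
have fE : f = 4 * e ^+ 2 by rewrite sqr_sqrtr; [field|lra].
exists (nth 0 [:: e; - 2 * e; e]).
rewrite fE => -[|[|[|//]]] _; rewrite /lag !big_ord_recr !big_ord0 /=; lra.
Qed.

(** The factor u of the spectrum contributes 1 - z to c, as |1 - z|^2 = 2 u; the
other factor is halved accordingly. *)
Lemma spectral_factor3 (R : rcfType) (f0 f1 f2 : R) :
    (forall u, 0 <= u <= 2 -> 0 < f0 + f1 * u + f2 * u ^+ 2) ->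
  exists c : nat -> R, has_spectrum c c 3 (nth 0 [:: 0; f0; f1; f2]).
Proof.
move=> f_gt0.
have [|p0 [p1 [p2 [f0E f1E f2E]]]] := @quadratic_factor _ (f0 / 2) (f1 / 2) (f2 / 2).
  by move=> u /f_gt0; lra.
exists (nth 0 [:: p0; p1 - p0; p2 - p1; - p2]).
have -> : f0 = 2 * (p0 + p1 + p2) ^+ 2 by lra.
have -> : f1 = 2 * (- (2 * p1 * (p0 + p2)) - 8 * p0 * p2) by lra.
have -> : f2 = 2 * (4 * p0 * p2) by lra.
case=> [|[|[|[|//]]]] _; rewrite /lag !big_ord_recr !big_ord0 /=; lra.
Qed.

Lemma spectral_factor4 (R : rcfType) (f0 f1 f2 f3 : R) : 0 < f3 ->
    (forall u, 0 <= u -> 0 < f0 + f1 * u + f2 * u ^+ 2 + f3 * u ^+ 3) ->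
  exists c : nat -> R, has_spectrum c c 4 (nth 0 [:: 0; f0; f1; f2; f3]).
Proof.
move=> f3_gt0 /(cubic_split f3_gt0)[rho [q0 [q1 [q2 [rho0 q_gt0 [f0E f1E f2E f3E]]]]]].
have [al [be [rhoE oneE]]] := linear_factor rho0.
have [|p0 [p1 [p2 [q0E q1E q2E]]]] := @quadratic_factor _ (q0 / 2) (q1 / 2) (q2 / 2).
  by move=> u /andP[/q_gt0 + _]; lra.
have q0E' : q0 = 2 * (p0 + p1 + p2) ^+ 2 by lra.
have q1E' : q1 = 2 * (- (2 * p1 * (p0 + p2)) - 8 * p0 * p2) by lra.
have q2E' : q2 = 2 * (4 * p0 * p2) by lra.
exists (nth 0 [:: al * p0; al * p1 + (be - al) * p0;
  al * p2 + (be - al) * p1 - be * p0; (be - al) * p2 - be * p1; - (be * p2)]).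
(* Multiplying by - (2 al be) = 1 makes the goal a polynomial identity in the
   coefficients of the factors. *)
have f1E' : f1 = - (2 * al * be) * q0 + rho * q1 by rewrite oneE mul1r.
have f2E' : f2 = - (2 * al * be) * q1 + rho * q2 by rewrite oneE mul1r.
have f3E' : f3 = - (2 * al * be) * q2 by rewrite oneE mul1r.
rewrite f0E f1E' f2E' f3E' -rhoE q0E' q1E' q2E'.
case=> [|[|[|[|[|//]]]]] _; rewrite /lag !big_ord_recr !big_ord0 /=; lra.
Qed.

(** * The multistep schemes *)

(** The coefficients of B + tau C, aligned with the window of A, which starts one
term earlier. *)
Definition coefBC (R : realType) (k : nat) (s : R) (i : nat) : R :=
  if i is j.+1 then Defs.coefB k j s + tau R k * Defs.coefC k j s else 0.

Lemma spectrum_coefBC2 (R : realType) (s : R) :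
  has_spectrum (fun i => coefA 2 i s) (coefBC 2 s) 2 (nth 0 [:: 0; 0;
  s * (2 * s - 1)]).
Proof.
case=> [|[|[|//]]] _; rewrite /lag !big_ord_recr !big_ord0 /= /tau.
all: lra.
Qed.

Lemma spectrum_coefBC3 (R : realType) (s : R) :
  has_spectrum (fun i => coefA 3 i s) (coefBC 3 s) 3 (nth 0 [:: 0; 47 / 250;
  1 / 3 - 53 / 300 * s - 453 / 500 * s ^+ 2;
  - (47 / 750) - 641 / 1500 * s - 53 / 300 * s ^+ 2 + 641 / 500 * s ^+ 3 + 547 / 500 * s ^+ 4]).
Proof.
case=> [|[|[|[|//]]]] _; rewrite /lag !big_ord_recr !big_ord0 /= /tau.
all: lra.
Qed.

Lemma spectrum_coefBC4 (R : realType) (s : R) :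
  has_spectrum (fun i => coefA 4 i s) (coefBC 4 s) 4 (nth 0 [:: 0; 11 / 20; - (11 / 120);
  31 / 60 + 43 / 40 * s - 29 / 40 * s ^+ 2 - 223 / 120 * s ^+ 3 - 2 / 3 * s ^+ 4;
  - (11 / 60) - 89 / 120 * s - 21 / 40 * s ^+ 2 + 83 / 60 * s ^+ 3 + 101 / 40 * s ^+ 4 + 35 / 24 * s ^+ 5 + 17 / 60 * s ^+ 6]).
Proof.
case=> [|[|[|[|[|//]]]]] _; rewrite /lag !big_ord_recr !big_ord0 /= /tau.
all: lra.
Qed.

Lemma spectrum3_gt0 (R : realFieldType) (s u : R) : 1 <= s ->
  0 < 47 / 250 + (1 / 3 - 53 / 300 * s - 453 / 500 * s ^+ 2) * u +
  (- (47 / 750) - 641 / 1500 * s - 53 / 300 * s ^+ 2 + 641 / 500 * s ^+ 3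
   + 547 / 500 * s ^+ 4) * u ^+ 2.
Proof.
move=> s1; set f1 := (1 / 3 - _ - _); set f2 := (- (47 / 750) - _ - _ + _ + _).
have [t t0 sE] : exists2 t, 0 <= t & s = 1 + t by exists (s - 1); lra.
have tn n : 0 <= t ^+ n by rewrite exprn_ge0.
have t2 := tn 2%N; have t3 := tn 3%N; have t4 := tn 4%N.
have f2_gt0 : 0 < f2.
  by rewrite /f2 sE; lra.
have disc : 0 < 4 * (47 / 250) * f2 - f1 ^+ 2.
  by rewrite /f2 /f1 sE; lra.
have : 0 < 4 * f2 * (47 / 250 + f1 * u + f2 * u ^+ 2).
  have -> : 4 * f2 * (47 / 250 + f1 * u + f2 * u ^+ 2) =
    (f1 + 2 * f2 * u) ^+ 2 + (4 * (47 / 250) * f2 - f1 ^+ 2) by ring.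
  by rewrite ltr_wpDl ?sqr_ge0.
by rewrite pmulr_rgt0// mulr_gt0.
Qed.

(** For large s the minimum over u is near 80 / 51 s^-2 (1 - 2.36 / s). The
point m = 1.57 / (s^2 + 9/4 s + 1) follows it from above, so that the slope at m
is nonnegative. The cubic is the sum of f3 (u - m)^2 (u + 2 m + f2 / f3) and of
its tangent at m, and both are nonnegative for u >= 0. *)
Lemma spectrum4_gt0 (R : realFieldType) (s u : R) : 1 <= s -> 0 <= u ->
  let f2 := 31 / 60 + 43 / 40 * s - 29 / 40 * s ^+ 2 - 223 / 120 * s ^+ 3
    - 2 / 3 * s ^+ 4 in
  let f3 := - (11 / 60) - 89 / 120 * s - 21 / 40 * s ^+ 2 + 83 / 60 * s ^+ 3
    + 101 / 40 * s ^+ 4 + 35 / 24 * s ^+ 5 + 17 / 60 * s ^+ 6 in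
  0 < f3 /\ 0 < 11 / 20 + - (11 / 120) * u + f2 * u ^+ 2 + f3 * u ^+ 3.
Proof.
move=> s1 u0 f2 f3.
have [t t0 sE] : exists2 t, 0 <= t & s = 1 + t by exists (s - 1); lra.
have tn n : 0 <= t ^+ n by rewrite exprn_ge0.
have t2 := tn 2%N; have t3 := tn 3%N; have t4 := tn 4%N; have t5 := tn 5%N.
have t6 := tn 6%N; have t7 := tn 7%N; have t8 := tn 8%N; have t9 := tn 9%N.
have f3_gt0 : 0 < f3 by rewrite /f3 sE; lra.
split=> //.
pose D := s ^+ 2 + 9 / 4 * s + 1; pose m := 157 / 100 / D.
have D0 : 0 < D by rewrite /D sE; lra.
have n0 : 0 <= 2 * m + f2 / f3.
  have -> : 2 * m + f2 / f3 = (2 * (157 / 100) * f3 + f2 * D) / (D * f3).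
    by rewrite /m; field; rewrite !gt_eqF.
  rewrite divr_ge0 ?mulr_ge0 1?ltW// /D /f2 /f3 sE; lra.
have slope : 0 <= - (11 / 120) + 2 * f2 * m + 3 * f3 * m ^+ 2.
  have -> : - (11 / 120) + 2 * f2 * m + 3 * f3 * m ^+ 2 =
    (- (11 / 120) * D ^+ 2 + 2 * f2 * (157 / 100) * D
     + 3 * f3 * (157 / 100) ^+ 2) / D ^+ 2.
    by rewrite /m; field; rewrite !gt_eqF.
  rewrite divr_ge0 ?exprn_ge0 1?ltW// /D /f2 /f3 sE; lra.
have value : 0 < 11 / 20 - f2 * m ^+ 2 - 2 * f3 * m ^+ 3.
  have -> : 11 / 20 - f2 * m ^+ 2 - 2 * f3 * m ^+ 3 =
    (11 / 20 * D ^+ 3 - f2 * (157 / 100) ^+ 2 * D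
     - 2 * f3 * (157 / 100) ^+ 3) / D ^+ 3.
    by rewrite /m; field; rewrite !gt_eqF.
  rewrite divr_gt0 ?exprn_gt0// /D /f2 /f3 sE; lra.
have -> : 11 / 20 + - (11 / 120) * u + f2 * u ^+ 2 + f3 * u ^+ 3 =
  f3 * (u - m) ^+ 2 * (u + (2 * m + f2 / f3)) +
  (- (11 / 120) + 2 * f2 * m + 3 * f3 * m ^+ 2) * u +
  (11 / 20 - f2 * m ^+ 2 - 2 * f3 * m ^+ 3).
  by field; rewrite !gt_eqF.
apply: ltr_wpDl value; apply: addr_ge0; last exact: mulr_ge0.
by apply: mulr_ge0; [rewrite pmulr_rge0// sqr_ge0|exact: addr_ge0].
Qed.

Lemma scheme_spectral_factor (R : realType) (s : R) k : 1 <= s -> (2 <= k <= 4)%N ->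
  exists c, balanced (supply (fun i => Defs.coefA k i s) (coefBC k s) c) k.
Proof.
move=> s1; case: k => [|[|[|[|[|//]]]]] // _.
- have [|c cE] := @spectral_factor2 _ (s * (2 * s - 1)).
    by apply: mulr_ge0; lra.
  by exists c; exact: spectrum_balanced (spectrum_coefBC2 s) cE.
- have [c cE] := @spectral_factor3 _ _ _ _ (fun u _ => spectrum3_gt0 u s1).
  by exists c; exact: spectrum_balanced (spectrum_coefBC3 s) cE.
- have P (u : R) (u0 : 0 <= u) := spectrum4_gt0 s1 u0.
  have [c cE] := spectral_factor4 (P 0 (lexx 0)).1 (fun u u0 => (P u u0).2).
  by exists c; exact: spectrum_balanced (spectrum_coefBC4 s) cE.
Qed.

Lemma scheme_schur (R : realType) (s : R) k : 1 <= s -> (2 <= k <= 4)%N ->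
  posform (storage (schur_cohn (coefBC k s) k)) k.
Proof.
move=> s1; case: k => [|[|[|[|[|//]]]]] // _.
- by apply: schur_cohn2_posform; rewrite /tau /=; [by []|lra].
- have [t t0 sE] : exists2 t, 0 <= t & s = 1 + t by exists (s - 1); lra.
  have t2 : 0 <= t ^+ 2 by rewrite exprn_ge0.
  by apply: schur_cohn3_posform; rewrite /tau /= ?sE; [by []|lra|lra|lra].
- have [t t0 sE] : exists2 t, 0 <= t & s = 1 + t by exists (s - 1); lra.
  have tn n : 0 <= t ^+ n by rewrite exprn_ge0.
  have t2 := tn 2%N; have t3 := tn 3%N; have t4 := tn 4%N; have t5 := tn 5%N.
  have t6 := tn 6%N.
  by apply: schur_cohn4_posform; rewrite /tau /= ?sE; [by []|lra|lra|lra].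
Qed.

Lemma coefBC_last_neq0 (R : realType) (s : R) k : 1 <= s -> (2 <= k <= 4)%N ->
  coefBC k s k != 0.
Proof.
move=> s1; have [t t0 sE] : exists2 t, 0 <= t & s = 1 + t by exists (s - 1); lra.
have t2 : 0 <= t ^+ 2 by rewrite exprn_ge0.
have t3 : 0 <= t ^+ 3 by rewrite exprn_ge0.
by case: k => [|[|[|[|[|//]]]]] // _; apply/lt0r_neq0; rewrite /tau /= sE; lra.
Qed.

Lemma scheme_no_common_solution (R : realType) (s : R) k : 1 <= s -> (2 <= k <= 4)%N ->
  no_common_solution (fun i => Defs.coefA k i s) (coefBC k s) k.
Proof.
move=> s1; have [t t0 sE] : exists2 t, 0 <= t & s = 1 + t by exists (s - 1); lra.
have tn n : 0 <= t ^+ n by rewrite exprn_ge0.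
have t2 := tn 2%N; have t3 := tn 3%N; have t4 := tn 4%N; have t5 := tn 5%N.
have t6 := tn 6%N.
case: k => [|[|[|[|[|//]]]]] // _; apply: no_common_solutionS.
- by rewrite !big_ord_recr big_ord0 /=; lra.
- by [].
- by rewrite !big_ord_recr big_ord0 /= /tau; lra.
- by rewrite /=; lra.
- by apply: bezout1; apply/lt0r_neq0; rewrite /minor !big_ord_recr !big_ord0 /= /tau sE; lra.
- by rewrite !big_ord_recr big_ord0 /=; lra.
- by [].
- by rewrite !big_ord_recr big_ord0 /= /tau; lra.
- by rewrite /= sE; lra.
- by apply: bezout2; apply/lt0r_neq0; rewrite /minor !big_ord_recr !big_ord0 /= /tau sE; lra.
- by rewrite !big_ord_recr big_ord0 /=; lra.
- by [].
- by rewrite !big_ord_recr big_ord0 /= /tau; lra.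
- by rewrite /= sE; lra.
- set f := (X in no_common_solution X _ _); set g := (X in no_common_solution _ X _).
  apply: bezout3; apply/lt0r_neq0.
  (* The terms of degree 5 and 6 in t cancel in each minor; reducing the minors
     first keeps the expansion of the determinant small. *)
  have w10 : minor f g 1 0 = (-22 - 71 * t - 30 * t ^+ 2 + 48 * t ^+ 3 + 29 * t ^+ 4) / 960.
    by rewrite /minor /f /g !big_ord_recr !big_ord0 /= /tau sE; lra.
  have w20 : minor f g 2 0 = (110 + 260 * t - 84 * t ^+ 2 - 212 * t ^+ 3 - 58 * t ^+ 4) / 960.
    by rewrite /minor /f /g !big_ord_recr !big_ord0 /= /tau sE; lra.
  have w21 : minor f g 2 1 = (-308 - 597 * t + 516 * t ^+ 2 + 492 * t ^+ 3 + 87 * t ^+ 4) / 960.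
    by rewrite /minor /f /g !big_ord_recr !big_ord0 /= /tau sE; lra.
  have w30 : minor f g 3 0 = (-46 + 129 * t + 288 * t ^+ 2 + 164 * t ^+ 3 + 29 * t ^+ 4) / 960.
    by rewrite /minor /f /g !big_ord_recr !big_ord0 /= /tau sE; lra.
  have w31 : minor f g 3 1 = (16 - 776 * t - 1068 * t ^+ 2 - 444 * t ^+ 3 - 58 * t ^+ 4) / 960.
    by rewrite /minor /f /g !big_ord_recr !big_ord0 /= /tau sE; lra.
  have w32 : minor f g 3 2 = (564 + 1313 * t + 954 * t ^+ 2 + 280 * t ^+ 3 + 29 * t ^+ 4) / 960.
    by rewrite /minor /f /g !big_ord_recr !big_ord0 /= /tau sE; lra.
  rewrite w10 w20 w21 w30 w31 w32; lra.
Qed.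

(** * The energy identity *)

Lemma L2dot_lincomb (R : realType) (d : nat) (Omega : set 'rV[R]_d)
    (oOmega : open Omega) (a b : nat -> R) (v : nat -> L2 oOmega) m :
  L2dot (\sum_(i < m) a i *: v i) (\sum_(i < m) b i *: v i) =
  pairing (fun i j => a i * b j) m (fun i j => L2dot (v i) (v j)).
Proof.
have suml (c : nat -> R) w :
    L2dot (\sum_(i < m) c i *: v i) w = \sum_(i < m) c i * L2dot (v i) w.
  rewrite (big_morph (fun f => L2dot f w) (fun f g => L2dotDl f g w) (id1 := 0)).
    by apply: eq_bigr => i _; rewrite L2dotZl.
  by rewrite -(scale0r (0 : L2 oOmega)) L2dotZl mul0r.
rewrite suml; apply: eq_bigr => i _; rewrite L2dotC suml mulr_sumr.
by apply: eq_bigr => j _; rewrite [L2dot (v j) _]L2dotC mulrA.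
Qed.

Unset Implicit Arguments.

(* The row and column indices i, j : 'I_k are 0-based, hence the i.+1, j.+1
   for the paper's 1-based h_{i,j}. *)
Theorem lemma3p3 (R : realType) (d : nat) (hd : (1 <= d <= 3)%N)
    (Omega : set 'rV[R]_d) (oOmega : open Omega) (bOmega : bounded_set Omega)
    (s : R) (hs : 1 <= s) (k : nat) (hk : (2 <= k <= 4)%N) :
  exists (H : 'M[R]_k) (theta : 'I_k.+1 -> R),
    symposdef H /\
    forall (phi : int -> L2 oOmega) (n : int),
      L2dot (opA k s phi (n + 1))
            (opB k s phi (n + 1) + tau R k *: opC k s phi (n + 1)) =
      \sum_(i < k) \sum_(j < k)
        H i j * L2dot (phi (n - k%:Z + 1 + i.+1%:Z)) (phi (n - k%:Z + 1 + j.+1%:Z))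
      - \sum_(i < k) \sum_(j < k)
        H i j * L2dot (phi (n - k%:Z + i.+1%:Z)) (phi (n - k%:Z + j.+1%:Z))
      + L2norm (\sum_(i < k.+1) theta i *: phi (n - k%:Z + 1 + i%:Z)) ^+ 2.
Proof.
have [c balanced_c] := scheme_spectral_factor hs hk.
set S := supply _ _ _ in balanced_c.
have S_pos : posform (storage S) k.
  apply: (storage_posform balanced_c).
  - exact: coefBC_last_neq0.
  - exact: scheme_schur.
  - exact: scheme_no_common_solution.
exists (\matrix_(i, j) storage S i j), (fun i => c i); split.
  by apply: posform_symposdef => //; apply: storage_sym; exact: supply_sym.
move=> phi n; pose v i := phi (n + 1 - k%:Z + i%:Z).
have bcE : opB k s phi (n + 1) + tau R k *: opC k s phi (n + 1) =
    \sum_(i < k.+1) coefBC k s i *: v i.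
  rewrite big_ord_recl scale0r add0r /opB /opC scaler_sumr -big_split /=.
  apply: eq_bigr => i _; rewrite scalerA -scalerDl; congr (_ *: phi _).
  by rewrite intS; ring.
have aE : opA k s phi (n + 1) = \sum_(i < k.+1) Defs.coefA k i s *: v i by [].
have v1E i : phi (n - k%:Z + 1 + i%:Z) = v i by congr phi; ring.
have v0E i : phi (n - k%:Z + i.+1%:Z) = v i by congr phi; rewrite intS; ring.
rewrite aE bcE (L2dot_lincomb (fun i => Defs.coefA k i s)); under [X in L2norm X]eq_bigr do rewrite v1E.
rewrite L2normE (L2dot_lincomb c c v).
have -> : pairing (fun i j => Defs.coefA k i s * coefBC k s j) k.+1
    (fun i j => L2dot (v i) (v j)) =
  pairing S k.+1 (fun i j => L2dot (v i) (v j)) +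
  pairing (fun i j => c i * c j) k.+1 (fun i j => L2dot (v i) (v j)).
  by rewrite pairing_supply ?subrK// => i j; exact: L2dotC.
rewrite (pairing_storage _ (@supply_sym _ _ _ _) balanced_c).
congr (_ - _ + _).
  by apply: eq_bigr => i _; apply: eq_bigr => j _; rewrite mxE !v1E.
by apply: eq_bigr => i _; apply: eq_bigr => j _; rewrite mxE !v0E.
Qed.
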